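(* Let $f:\mathbb{R}^d\to\mathbb{R}$ be differentiable and convex, let $x_0\in\mathbb{R}^d$, and suppose $f$ is $C^2$ on the sublevel set $S:=\{x\in\mathbb{R}^d:\ f(x)\le f(x_0)\}$. Suppose there exist $\kappa>0$ and a real symmetric positive semidefinite $d\times d$ matrix $A$, with largest eigenvalue $L_A:=\lambda_{\max}(A)$, such that $$\nabla^2 f(x)\preceq \kappa A\qquad\text{for all } x\in S.$$ Let $L_{\mathrm{eff}}:=\kappa L_A$. Then for every constant stepsize $\eta\in\bigl(0,\,1.75/L_{\mathrm{eff}}\bigr]$, the gradient descent iterates $x_{n+1}=x_n-\eta\nabla f(x_n)$, $n\ge0$, started at $x_0$, have a convex optimization curve $\{f(x_n)\}_{n\ge0}$.
   Context: A real sequence $\{a_n\}_{n\ge0}$ is called convex if $a_{n+1}-a_n\le a_{n+2}-a_{n+1}$ for all $n\ge0$. The optimization curve of an iteration $(x_n)_{n\ge 0}$ is the real sequence $\{f(x_n)\}_{n\ge0}$. The symbol $\preceq$ denotes the Loewner order on symmetric matrices: $M\preceq N$ means $N-M$ is positive semidefinite. *)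

(* Defs.v *)
From mathcomp Require Import all_boot all_order all_algebra.
From mathcomp Require Import all_classical all_reals all_analysis.

Set Implicit Arguments.
Unset Strict Implicit.
Unset Printing Implicit Defensive.

Import Order.TTheory GRing.Theory Num.Theory numFieldNormedType.Exports.

Local Open Scope classical_set_scope.
Local Open Scope ring_scope.

Section Definitions.
Context {R : realType} {d : nat}.
Implicit Types (f : 'rV[R]_d -> R) (x : 'rV[R]_d) (M N A : 'M[R]_d).

Definition grad f x : 'rV[R]_d := \row_i 'D_(delta_mx 0 i) f x.

(* The (i, j) entry of the Jacobian of g is the i-th partial derivative of
   the j-th component of g. *)
Definition hessian f x : 'M[R]_d := jacobian (grad f) x.

Definition sublevel f (c : R) : set 'rV[R]_d := [set x | f x <= c].

(* Meant for f differentiable on the whole space, so that grad f is a true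
   gradient around every point of S, and for S not necessarily open: the
   Hessian exists at every point of S, boundary included, and is continuous as
   a map on the subspace S. This holds in particular when f is C^2 on an open
   set containing S. *)
Definition C2_on (S : set 'rV[R]_d) f : Prop :=
  (forall x, S x -> differentiable (grad f) x) /\
  {within S, continuous (hessian f)}.

Definition psd M : Prop :=
  M^T = M /\ forall v : 'rV[R]_d, 0 <= (v *m M *m v^T) 0 0.

Definition loewner_le M N : Prop := psd (N - M).

Definition largest_eigenvalue A (l : R) : Prop :=
  eigenvalue A l /\ forall l', eigenvalue A l' -> l' <= l.

Definition gd f (eta : R) x (n : nat) : 'rV[R]_d :=
  iter n (fun y => y - eta *: grad f y) x.

End Definitions.

Definition convex_seq (R : realType) (a : nat -> R) : Prop :=
  forall n, a n.+1 - a n <= a n.+2 - a n.+1.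

(* Main.v *)
(* Enlarging the smoothness constant to L = 7/(4 eta), one needs
   f x0 + f x2 - 2 f x1 >= 0 for three consecutive iterates. Smoothness holds
   only on the sublevel set S, so the global inequality
     D(y, x) : f y >= f x + <f' x, y - x> + |f' y - f' x|^2 / (2 L)
   is not available for all x and y in S: its proof evaluates f at
   y - (f' y - f' x) / L. That point lies in S as soon as the quadratic upper
   model of f at y puts it there. When f x0 - f x2 is at least
   (|f' x0|^2 - |f' x2|^2) / (2 L), this applies to D(x0, x1), D(x2, x1) and
   D(x2, x0), whose combination gives the claim; otherwise f x0 - f x2 is so
   small that D(x0, x1) and the cocoercivity of the gradient between x0 and x2,
   which only involves a segment of S, suffice. *)

Require Import Defs.
From mathcomp Require Import all_boot all_order all_algebra.
From mathcomp Require Import all_classical all_reals all_analysis.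
From mathcomp Require Import ring lra.
Import Order.TTheory GRing.Theory Num.Theory numFieldNormedType.Exports.
Local Open Scope classical_set_scope.
Local Open Scope ring_scope.

(** * Euclidean inner product on row vectors *)

Section EuclideanProduct.
Context {R : realType} {d : nat}.
Implicit Types u v w : 'rV[R]_d.

(** In this form the quadratic form inside [psd] is [dotv (v *m M) v] by mere unfolding. *)
Definition dotv u v : R := (u *m v^T) 0 0.

Lemma dotvE u v : dotv u v = \sum_i u 0 i * v 0 i.
Proof. by rewrite /dotv mxE; apply: eq_bigr => i _; rewrite mxE. Qed.

Lemma dotvC u v : dotv u v = dotv v u.
Proof. by rewrite !dotvE; apply: eq_bigr => i _; rewrite mulrC. Qed.

Lemma dotvDl u v w : dotv (u + v) w = dotv u w + dotv v w.
Proof. by rewrite /dotv mulmxDl mxE. Qed.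

Lemma dotvZl k u v : dotv (k *: u) v = k * dotv u v.
Proof. by rewrite /dotv -scalemxAl mxE. Qed.

Lemma dotvNl u v : dotv (- u) v = - dotv u v.
Proof. by rewrite -scaleN1r dotvZl mulN1r. Qed.

Lemma dotvDr u v w : dotv w (u + v) = dotv w u + dotv w v.
Proof. by rewrite dotvC dotvDl !(dotvC w). Qed.

Lemma dotvZr k u v : dotv v (k *: u) = k * dotv v u.
Proof. by rewrite dotvC dotvZl dotvC. Qed.

Lemma dotvNr u v : dotv v (- u) = - dotv v u.
Proof. by rewrite dotvC dotvNl dotvC. Qed.

Definition dotv_lin := (dotvDl, dotvDr, dotvZl, dotvZr, dotvNl, dotvNr).

Lemma dotvv_ge0 u : 0 <= dotv u u.
Proof. by rewrite dotvE sumr_ge0// => i _; rewrite -expr2 sqr_ge0. Qed.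

Lemma dotvv_eq0 u : (dotv u u == 0) = (u == 0).
Proof.
apply/eqP/eqP => [|->]; last by rewrite /dotv mul0mx mxE.
rewrite dotvE => /eqP; rewrite psumr_eq0 => [/allP u0|i _]; last first.
  by rewrite -expr2 sqr_ge0.
apply/rowP => i; rewrite mxE; apply/eqP.
by have := u0 i (mem_index_enum i); rewrite mulf_eq0 orbb.
Qed.

Lemma dotv_continuous w : continuous (dotv ^~ w).
Proof.
have -> : dotv ^~ w = fun u => \sum_i u 0 i * w 0 i.
  by apply/funext => u; exact: dotvE.
apply: continuous_big => [|i _ u]; first exact: (@add_continuous R^o).
apply: (@cvgM R _ (nbhs u) _ (fun M : 'rV[R]_d => M 0 i) (fun=> w 0 i)).
  exact: coord_continuous.
exact: cvg_cst.
Qed.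

End EuclideanProduct.

(** * Derivative bounds for real functions of one variable *)

Section RealCurve.
Context {R : realType}.
Implicit Types h dh : R -> R.

Lemma is_derive_ge_increment h dh (C : R) :
  (forall t : R, 0 <= t <= 1 -> is_derive t (1 : R) h (dh t)) ->
  (forall t : R, 0 < t < 1 -> C <= dh t) -> h 0 + C <= h 1.
Proof.
move=> hd dhC.
have [||c] := @MVT R h dh 0 1 ltr01.
- move=> t; rewrite in_itv/= => /andP[t0 t1]; apply: hd.
  by rewrite !ltW.
- apply: derivable_within_continuous => t; rewrite in_itv/= => t01.
  by have [] := hd t t01.
rewrite in_itv/= subr0 mulr1 => c01 hE.
by rewrite -lerBrDl hE dhC.
Qed.

(** The derivative is also the limit of the difference quotients from the right, so bounds for small
    positive [t] suffice. *)
Lemma is_derive_le_slope h (a C : R) :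
  is_derive (0 : R) (1 : R) h a ->
  (forall t : R, 0 < t <= 1 -> h t - h 0 <= t * C) ->
  a <= C.
Proof.
move=> [hd <-] hC.
rewrite /derive (cvg_at_rightE _ _ hd); apply: limr_le.
  apply: cvgP; apply: cvg_trans hd; apply: cvg_app => A [e e0 Ae].
  by exists e => // t te t0; apply: Ae => //; exact/lt0r_neq0.
near=> t.
have t0 : 0 < t by near: t; exact: nbhs_right_gt.
have t1 : t <= 1 by near: t; exact: nbhs_right_le.
rewrite /= addr0 /shift/=.
rewrite [t *: 1]mulr1 ler_pdivrMl//.
by apply: hC; rewrite t0.
Unshelve. all: by end_near.
Qed.

End RealCurve.

(** * Derivatives along lines *)

Section Lines.
Context {R : realType} {d : nat}.
Implicit Types x u w : 'rV[R]_d.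

Lemma is_derive_line (V : normedModType R) (F : 'rV[R]_d -> V) x u (t : R) :
  differentiable F (x + t *: u) ->
  is_derive t (1 : R) (fun s => F (x + s *: u)) ('D_u F (x + t *: u)).
Proof.
move=> /(@diff_derivable _ _ _ _ _ u) dF.
have E : (fun h : R => h^-1 *: (((fun s => F (x + s *: u)) \o shift t) (h *: 1)
    - F (x + t *: u))) =
  (fun h : R => h^-1 *: ((F \o shift (x + t *: u)) (h *: u) - F (x + t *: u))).
  apply/funext => h /=; congr (_ *: (F _ - _)).
  by rewrite [h *: 1]mulr1 scalerDl addrCA.
split; first by rewrite /derivable E.
by rewrite /derive E.
Qed.

Lemma is_derive_dotv (F : R -> 'rV[R]_d) (dF : 'rV[R]_d) w (t : R) :
  is_derive t (1 : R) F dF ->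
  is_derive t (1 : R) (fun s => dotv (F s) w) (dotv dF w).
Proof.
move=> [Fd FE].
have cv : h^-1 *: (((fun s => dotv (F s) w) \o shift t) (h *: (1 : R))
   - dotv (F t) w) @[h --> 0^'] --> dotv dF w.
  have -> : (fun h : R => h^-1 *: (((fun s => dotv (F s) w) \o shift t) (h *: 1)
      - dotv (F t) w)) =
    (dotv ^~ w) \o (fun h : R => h^-1 *: ((F \o shift t) (h *: 1) - F t)).
    by apply/funext => h /=; rewrite !dotv_lin.
  by apply: continuous_cvg; [exact: dotv_continuous|rewrite -FE].
by split; [exact: (cvgP _ cv)|exact: cvg_lim].
Qed.

Lemma derive_grad (f : 'rV[R]_d -> R) x u :
  differentiable f x -> 'D_u f x = dotv (grad f x) u.
Proof.
move=> fd; rewrite deriveE// {1}(row_sum_delta u) linear_sum dotvE.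
by apply: eq_bigr => i _; rewrite linearZ /= mxE deriveE// mulrC.
Qed.

End Lines.

(** * First- and second-order consequences of convexity *)

Section ConvexGradient.
Context {R : realType} {d : nat} (f : 'rV[R]_d -> R).
Hypothesis f_diff : forall x, differentiable f x.
Hypothesis f_convex : convex_function setT f.
Implicit Types x u : 'rV[R]_d.

Lemma convex_line x u (t : R) : 0 <= t <= 1 ->
  f (x + t *: u) <= f x + t * (f (x + u) - f x).
Proof.
move=> t01.
have := f_convex (Itv01 (proj1 (andP t01)) (proj2 (andP t01))).
move=> /(_ (x + u) x); rewrite !in_setT => /(_ isT isT).
rewrite convRE /conv/= /unstable.onem => fE.
rewrite [leRHS](_ : _ = t * f (x + u) + (1 - t) * f x); last by ring.
apply: le_trans fE.
by rewrite scalerDr addrAC -scalerDl subrKC scale1r.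
Qed.

Lemma is_derive_grad_line x u (t : R) :
  is_derive t (1 : R) (fun s => f (x + s *: u)) (dotv (grad f (x + t *: u)) u).
Proof. by rewrite -derive_grad//; exact: is_derive_line. Qed.

Lemma grad_subgradient x u : f x + dotv (grad f x) u <= f (x + u).
Proof.
have := is_derive_grad_line x u 0; rewrite scale0r addr0.
move=> /is_derive_le_slope fD; rewrite -lerBrDl; apply: fD => t /andP[t0 t1].
by rewrite scale0r addr0 lerBlDl; apply: convex_line; rewrite ltW.
Qed.

Lemma grad_monotone x u : 0 <= dotv (grad f (x + u) - grad f x) u.
Proof.
have := grad_subgradient x u; have := grad_subgradient (x + u) (- u).
by rewrite addrK !dotv_lin; lra.
Qed.

Lemma is_derive_hessian_line x u w (t : R) :
  differentiable (grad f) (x + t *: u) ->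
  is_derive t (1 : R) (fun s => dotv (grad f (x + s *: u)) w)
    (dotv (u *m hessian f (x + t *: u)) w).
Proof.
move=> gdiff; have := is_derive_line _ _ _ _ _ gdiff; rewrite deriveEjacobian//.
exact: (@is_derive_dotv R d (fun s => grad f (x + s *: u))).
Qed.

Lemma hessian_ge0 x u : differentiable (grad f) x ->
  0 <= dotv (u *m hessian f x) u.
Proof.
move=> gdiff.
(* Pairing with [- u] turns monotonicity of the gradient into the upper bound on slopes that
   [is_derive_le_slope] expects. *)
have := @is_derive_hessian_line x u (- u) 0; rewrite scale0r addr0.
move=> /(_ gdiff) /(is_derive_le_slope _ _ 0) gD.
rewrite -oppr_le0 -dotvNr; apply: gD => t /andP[t0 t1].
have := grad_monotone x (t *: u); rewrite dotvZr pmulr_rge0//.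
by rewrite scale0r addr0 mulr0 !dotv_lin; lra.
Qed.

End ConvexGradient.

(** * Smoothness inequalities confined to a sublevel set *)

Section SmoothSublevel.
Context {R : realType} {d : nat} (f : 'rV[R]_d -> R) (c L : R).
Hypothesis f_diff : forall x, differentiable f x.
Hypothesis f_convex : convex_function setT f.
Hypothesis L_gt0 : 0 < L.
Hypothesis grad_diff : forall x, f x <= c -> differentiable (grad f) x.
Hypothesis hessian_sym : forall x, f x <= c -> (hessian f x)^T = hessian f x.
Hypothesis hessian_le : forall x u, f x <= c ->
  dotv (u *m hessian f x) u <= L * dotv u u.
Implicit Types x y u w : 'rV[R]_d.

Lemma sublevel_line x u (t : R) : f x <= c -> f (x + u) <= c -> 0 <= t <= 1 ->
  f (x + t *: u) <= c.
Proof.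
move=> fx fxu t01; apply: le_trans (convex_line _ f_convex _ _ _ t01) _.
by case/andP: t01; nra.
Qed.

(* A symmetric [H] with [0 <= H <= L] satisfies, for [v := u - w / L],
   [<u H, u - 2 w / L> + <w, w> / L >= <v H, v> >= 0]; this is integrated along
   the segment from [x] to [x + u]. *)
Lemma grad_increment_ge x u w : f x <= c -> f (x + u) <= c ->
  - (L^-1 * dotv w w) <= dotv (grad f (x + u) - grad f x) (u - (2 / L) *: w).
Proof.
move=> fx fxu.
have := @is_derive_ge_increment R
  (fun s => dotv (grad f (x + s *: u)) (u - (2 / L) *: w))
  (fun t => dotv (u *m hessian f (x + t *: u)) (u - (2 / L) *: w))
  (- (L^-1 * dotv w w)).
rewrite scale0r addr0 scale1r dotvDl dotvNl lerBrDl; apply=> t t01.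
  by apply: is_derive_hessian_line; apply: grad_diff; exact: sublevel_line.
have fxt : f (x + t *: u) <= c.
  by apply: sublevel_line => //; case/andP: t01 => t0 t1; rewrite !ltW.
have := hessian_ge0 _ f_diff f_convex _ (u - L^-1 *: w) (grad_diff _ fxt).
have := hessian_le _ w fxt; have := hessian_sym _ fxt.
move: (hessian f _) => H HT Hw.
have HC : dotv (w *m H) u = dotv (u *m H) w.
  by rewrite [RHS]dotvC /dotv trmx_mul HT mulmxA.
have {Hw} : L^-1 * (L^-1 * dotv (w *m H) w) <= L^-1 * dotv w w.
  by rewrite ler_pM2l ?invr_gt0// ler_pdivrMl.
rewrite !mulmxDl !mulNmx -!scalemxAl !dotv_lin HC.
move: (dotv (w *m H) w) (dotv (u *m H) u) (dotv (u *m H) w) (dotv w w).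
by move=> a b e k; lra.
Qed.

(** Take [w] in [grad_increment_ge] to be the gradient increment itself. *)
Lemma grad_cocoercive x u : f x <= c -> f (x + u) <= c ->
  L^-1 * dotv (grad f (x + u) - grad f x) (grad f (x + u) - grad f x) <=
  dotv (grad f (x + u) - grad f x) u.
Proof.
move=> fx fxu.
have := grad_increment_ge x u (grad f (x + u) - grad f x) fx fxu.
by move: (grad f (x + u) - _) => w; rewrite !dotv_lin; lra.
Qed.

(** The Hessian bound is integrated twice along the segment: [lip] bounds the slope of [f], and the
    slope bound is then integrated. *)
Lemma descent x u : f x <= c -> f (x + u) <= c ->
  f (x + u) <= f x + dotv (grad f x) u + L / 2 * dotv u u.
Proof.
move=> fx fxu.
have lip t : 0 < t < 1 ->
    dotv (grad f (x + t *: u)) u <= dotv (grad f x) u + L * t * dotv u u.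
  case/andP => t0 t1.
  have fxt s : 0 <= s <= 1 -> f (x + s *: (t *: u)) <= c.
    move=> /andP[s0 s1]; rewrite scalerA; apply: sublevel_line => //.
    by rewrite mulr_ge0 ?mulr_ile1// ltW.
  have := @is_derive_ge_increment R
    (fun s => dotv (grad f (x + s *: (t *: u))) (- (t *: u)))
    (fun s => dotv (t *: u *m hessian f (x + s *: (t *: u))) (- (t *: u)))
    (- (L * dotv (t *: u) (t *: u))).
  rewrite scale0r addr0 scale1r => incr.
  have {}incr : dotv (grad f x) (- (t *: u)) - L * dotv (t *: u) (t *: u) <=
      dotv (grad f (x + t *: u)) (- (t *: u)).
    apply: incr => s s01.
      by apply: is_derive_hessian_line; apply: grad_diff; exact: fxt.
    rewrite dotvNr lerN2; apply: hessian_le; apply: fxt.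
    by case/andP: s01 => s0 s1; rewrite !ltW.
  by rewrite -(ler_pM2l t0); move: incr; rewrite !dotv_lin; lra.
have := @is_derive_ge_increment R
  (fun s => L / 2 * dotv u u * (s * s) - f (x + s *: u))
  (fun t => L * t * dotv u u - dotv (grad f (x + t *: u)) u)
  (- dotv (grad f x) u).
rewrite scale0r addr0 scale1r !mulr0 !mulr1 => incr.
suff : 0 - f x - dotv (grad f x) u <= L / 2 * dotv u u - f (x + u) by lra.
apply: incr => t t01; last by have := lip t t01; lra.
apply: is_deriveB; last exact: is_derive_grad_line.
have idD : is_derive t (1 : R) (id : R -> R) 1 by exact: is_derive_id.
have := is_deriveZ (L / 2 * dotv u u) (is_deriveM idD idD).
by move=> /is_derive_eq; apply; rewrite /GRing.scale/=; field.
Qed.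

(** Otherwise [f] takes the value [c] at some [x + t *: u] with [0 < t < 1]. As [u] is nonzero, the
    quadratic model is strictly convex in [t]; being at most [c] at both ends, it is below [c] at
    [t], against [descent]. *)
Lemma sublevel_step x u :
  f x <= c -> f x + dotv (grad f x) u + L / 2 * dotv u u <= c -> f (x + u) <= c.
Proof.
move=> fx fu; rewrite leNgt; apply/negP => fxu.
have u_gt0 : 0 < dotv u u.
  rewrite lt_def dotvv_ge0 andbT dotvv_eq0; apply: contraTneq fxu => ->.
  by rewrite addr0 -leNgt.
(* The intermediate value argument starts strictly below [c]: at [x], or, if [f x = c], further
   along the segment, since the model bound then forces a negative initial slope. *)
have [s /andP[s0 s1] fs] : exists2 s : R, 0 <= s <= 1 & f (x + s *: u) < c.
  have [fxc|xfc] := ltP (f x) c.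
    by exists 0; rewrite ?lexx ?ler01// scale0r addr0.
  apply: contrapT => nos.
  have : - dotv (grad f x) u <= 0.
    have := is_deriveN (is_derive_grad_line _ f_diff x u 0).
    rewrite scale0r addr0 => /is_derive_le_slope; apply => t /andP[t0 t1].
    rewrite mulr0 /= !opprfctE scale0r addr0.
    suff : c <= f (x + t *: u) by lra.
    by rewrite leNgt; apply/negP => ft; apply: nos; exists t => //; rewrite ltW.
  by have : 0 < L * dotv u u; [exact: mulr_gt0|lra].
have [||t] := @IVT R (fun s => f (x + s *: u)) s 1 c s1.
- apply: derivable_within_continuous => t _.
  by have [] := is_derive_grad_line _ f_diff x u t.
- by rewrite scale1r ge_min le_max (ltW fs) (ltW fxu) orbT.
rewrite in_itv/= => /andP[st t1] ft.
have {st} t0 : 0 < t.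
  apply: le_lt_trans s0 _; rewrite lt_def st andbT; apply: contraTneq fs => <-.
  by rewrite ft ltxx.
have {}t1 : t < 1.
  rewrite lt_def t1 andbT; apply: contraTneq fxu => t1E.
  by rewrite -leNgt -ft -t1E scale1r.
have := descent x (t *: u) fx; rewrite ft lexx !dotv_lin => /(_ isT).
have : 0 < L * (t * (1 - t)) * dotv u u.
  by rewrite !mulr_gt0// subr_gt0.
have : t * (f x + dotv (grad f x) u + L / 2 * dotv u u) <= t * c.
  by rewrite ler_pM2l.
have : (1 - t) * f x <= (1 - t) * c by rewrite ler_pM2l// subr_gt0.
lra.
Qed.

(** The point [y - w / L] minimizes the upper model at [y] minus the tangent at [x]; [descent] and
    the subgradient inequality are compared there. The second hypothesis bounds the model at that
    point, which keeps it in the sublevel set. *)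
Lemma gradient_gap x y :
  f y <= c ->
  f y - L^-1 * dotv (grad f y) (grad f y - grad f x)
    + L^-1 / 2 * dotv (grad f y - grad f x) (grad f y - grad f x) <= c ->
  f x + dotv (grad f x) (y - x)
    + L^-1 / 2 * dotv (grad f y - grad f x) (grad f y - grad f x) <= f y.
Proof.
move wE : (grad f y - grad f x) => w fy fw.
have bound : f y + dotv (grad f y) (- (L^-1 *: w))
    + L / 2 * dotv (- (L^-1 *: w)) (- (L^-1 *: w)) =
    f y - L^-1 * dotv (grad f y) w + L^-1 / 2 * dotv w w.
  by rewrite !dotv_lin; field; exact: lt0r_neq0.
have fz : f (y - L^-1 *: w) <= c by apply: sublevel_step; rewrite ?bound.
have ww : dotv w w = dotv (grad f y) w - dotv (grad f x) w.
  by rewrite -{1}wE !dotv_lin.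
have := descent y _ fy fz; rewrite bound ww.
have := grad_subgradient _ f_diff f_convex x (y - L^-1 *: w - x).
by rewrite subrKC !dotv_lin; lra.
Qed.

Lemma sublevel_gd_step x : f x <= c -> f (x - (7 / 4 / L) *: grad f x) <= c.
Proof.
move=> fx; apply: sublevel_step => //; rewrite !dotv_lin.
(* Half the square of [7/4] is [49/32], which is below [7/4], so the model does not increase. *)
rewrite [X in _ + X](_ : _ = 49 / 32 / L * dotv (grad f x) (grad f x)).
  have : 0 <= L^-1 * dotv (grad f x) (grad f x).
    by rewrite mulr_ge0 ?dotvv_ge0// invr_ge0 ltW.
  lra.
by field; exact: lt0r_neq0.
Qed.

(* Write [g0], [g1], [g2] for the gradients at the three iterates and take
   [L = 1]. The gap inequalities at [(x0, x1)], [(x2, x1)], [(x2, x0)] with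
   weights [3/2], [1/2], [1/2] bound the second difference below by
   [|g2 - (g0 + g1) / 2|^2 / 2]; the last two are available when
   [f x0 - f x2 >= (|g0|^2 - |g2|^2) / 2]. When this fails, its negation and the
   first gap bound the second difference below by
   [|g1 + 3/4 g0|^2 - |g0|^2 / 16 + |g2|^2 / 2], which is [2/7] times the
   cocoercivity defect at [(x0, x2)] plus two squares. *)
Lemma gd_step_convex x0 x1 x2 :
  x1 = x0 - (7 / 4 / L) *: grad f x0 -> x2 = x1 - (7 / 4 / L) *: grad f x1 ->
  f x0 <= c -> f x1 - f x0 <= f x2 - f x1.
Proof.
move=> x1E x2E f0.
have f1 : f x1 <= c by rewrite x1E sublevel_gd_step.
have f2 : f x2 <= c by rewrite x2E sublevel_gd_step.
have x01 : x0 = x1 + (7 / 4 / L) *: grad f x0 by rewrite x1E subrK.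
have x12 : x1 = x2 + (7 / 4 / L) *: grad f x1 by rewrite x2E subrK.
have x02 : x0 = x2 + ((7 / 4 / L) *: grad f x1 + (7 / 4 / L) *: grad f x0).
  by rewrite addrA -x12.
have coc01 := grad_cocoercive x1 ((7 / 4 / L) *: grad f x0) f1.
have coc02 := grad_cocoercive x2
  ((7 / 4 / L) *: grad f x1 + (7 / 4 / L) *: grad f x0) f2.
rewrite -x01 in coc01; rewrite -x02 in coc02.
have gap01 := gradient_gap x1 x0 f0.
have gap21 := gradient_gap x1 x2 f2.
have gap20 := gradient_gap x0 x2 f2.
have d01 : x0 - x1 = (7 / 4 / L) *: grad f x0.
  by rewrite {1}x01 addrAC subrr add0r.
have d21 : x2 - x1 = - ((7 / 4 / L) *: grad f x1).
  by rewrite x2E addrAC subrr add0r.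
have d20 : x2 - x0 = - ((7 / 4 / L) *: grad f x1 + (7 / 4 / L) *: grad f x0).
  by rewrite {1}x02 opprD addrA subrr add0r.
rewrite d01 in gap01; rewrite d21 in gap21; rewrite d20 in gap20.
move: (coc01 f0) (coc02 f0) gap01 gap21 gap20.
have L0 : 0 <= L^-1 by rewrite invr_ge0 ltW.
move: (grad f x0) (grad f x1) (grad f x2) => g0 g1 g2.
have sq k0 k1 k2 :
    0 <= L^-1 * dotv (k0 *: g0 + k1 *: g1 + k2 *: g2)
                     (k0 *: g0 + k1 *: g1 + k2 *: g2).
  by rewrite mulr_ge0// dotvv_ge0.
(* The first square is the remainder when [f x0 - f x2] is large. The next two, with weights [1] and
   [1/28], are the remainder in the other case. The last gives [|g1| <= |g0|]. *)
move: (sq 1 1 (- 2)) (sq (1 / 2) 1 (1 / 4)) (sq 1 0 (- (9 / 2)))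
  (sq 1 (- 1) 0).
rewrite !dotv_lin (dotvC g1 g0) (dotvC g2 g0) (dotvC g2 g1).
move: (dotv g0 g0) (dotv g0 g1) (dotv g0 g2) (dotv g1 g1) (dotv g1 g2)
  (dotv g2 g2) => G00 G01 G02 G11 G12 G22.
move=> sq1 sq2 sq3 sq4 c01 c02 gap01 gap21 gap20.
(* The model bound in [gradient_gap x y] simplifies to [f y + (|f' x|^2 - |f' y|^2) / (2 L) <= c];
   for the pair [x1], [x0] it thus follows from [|g1| <= |g0|]. *)
have g10 : L^-1 * G11 <= L^-1 * G00 by lra.
have {}gap01 : _ := gap01 ltac:(lra).
(* The first alternative gives the model bound of [gap20], and through [g10] that of [gap21]. *)
have [le02|lt02] := leP (L^-1 / 2 * (G00 - G22)) (f x0 - f x2).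
  have {}gap21 : _ := gap21 ltac:(lra).
  have {}gap20 : _ := gap20 ltac:(lra).
  lra.
lra.
Qed.

End SmoothSublevel.

(** * Largest eigenvalue as a bound on the quadratic form *)

Section Rayleigh.
Context {R : realType} {d : nat}.
Implicit Types (A : 'M[R]_d) (u v w : 'rV[R]_d).

Lemma quadratic_form_continuous A : continuous (fun v => dotv (v *m A) v).
Proof.
have -> : (fun v => dotv (v *m A) v) =
    fun v => \sum_i dotv v (col i A)^T * v 0 i.
  apply/funext => v; rewrite dotvE; apply: eq_bigr => i _; congr (_ * _).
  by rewrite dotvE !mxE; apply: eq_bigr => j _; rewrite !mxE.
apply: continuous_big => [|i _ u]; first exact: (@add_continuous R^o).
apply: (@cvgM R _ (nbhs u) _ (fun v => dotv v (col i A)^T) (fun v => v 0 i)).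
  exact: dotv_continuous.
exact: coord_continuous.
Qed.

Lemma compact_unit_sphere : compact [set v : 'rV[R]_d | dotv v v = 1].
Proof.
apply: bounded_closed_compact.
  exists 1; split => // M M1 v /= v1; apply: le_trans (ltW M1).
  (* The ambient norm is the maximum norm, attained at an entry whose square is one term of
     [dotv v v]. *)
  have [v0|/mx_norm_neq0 [[i j] /= vE]] := eqVneq (mx_norm v) 0.
    by rewrite [`|v|]v0.
  rewrite [`|v|]vE -(expr_le1 (n := 2))// -normrX ger0_norm ?sqr_ge0//.
  rewrite -v1 dotvE (bigD1 j)//= ord1 expr2 lerDl.
  by apply: sumr_ge0 => k _; rewrite -expr2 sqr_ge0.
have -> : [set v : 'rV[R]_d | dotv v v = 1] =
    (fun v => dotv (v *m 1%:M) v) @^-1` [set 1].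
  by apply/seteqP; split => v /=; rewrite mulmx1.
apply: closed_comp => [v _|]; first exact: quadratic_form_continuous.
exact: closed_eq.
Qed.

(** The form at [v - t *: (v *m A)] is [- 2 t b + t^2 k]. For [t = b / (k + 1)], where the [1]
    avoids a zero denominator, this is [- t^2 (k + 2)], so nonnegativity forces [t = 0] and hence
    [b = 0]. *)
Lemma psd_form_kernel A v : psd A -> dotv (v *m A) v = 0 -> v *m A = 0.
Proof.
move=> [AT A0] vA0; apply/eqP; rewrite -dotvv_eq0.
have := A0 (v *m A); rewrite -/(dotv _ _).
set b := dotv (v *m A) (v *m A); set k := dotv _ _ => k0.
pose t := b / (k + 1).
have bE : b = t * (k + 1) by rewrite divfK// lt0r_neq0// ltr_wpDl.
have := A0 (v - t *: (v *m A)); rewrite -/(dotv _ _).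
rewrite !mulmxDl !mulNmx -!scalemxAl !dotv_lin vA0 -/b -/k.
have -> : dotv (v *m A *m A) v = b.
  by rewrite {1}/dotv -mulmxA -{2}AT -trmx_mul.
rewrite bE => t0.
have : t ^+ 2 * (k + 2) = 0.
  have := mulr_ge0 (sqr_ge0 t) (addr_ge0 k0 (ler0n R 2)); lra.
move/eqP; rewrite mulf_eq0 sqrf_eq0 (gt_eqF (ltr_wpDl k0 _))// orbF => /eqP ->.
by rewrite mul0r.
Qed.

(* The maximum [m] of the quadratic form on the unit sphere is attained at some
   [v]; there the nonnegative form of [m - A] vanishes, so [v (m - A) = 0]. *)
Lemma rayleigh_le A (l : R) :
  A^T = A -> (forall l', eigenvalue A l' -> l' <= l) ->
  forall u, dotv (u *m A) u <= l * dotv u u.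
Proof.
move=> AT Al u.
have [->|u0] := eqVneq u 0; first by rewrite mul0mx /dotv mul0mx mxE mulr0.
have normalize w : w != 0 -> exists2 k : R, 0 < k & dotv (k *: w) (k *: w) = 1.
  move=> w0; have w_gt0 : 0 < dotv w w by rewrite lt_def dotvv_eq0 w0 dotvv_ge0.
  exists (Num.sqrt (dotv w w))^-1; first by rewrite invr_gt0 sqrtr_gt0.
  rewrite !dotv_lin mulrA -expr2 exprVn sqr_sqrtr ?ltW// mulVf//.
  exact: lt0r_neq0.
have [||v] := @EVT_max_rV R d (fun v => dotv (v *m A) v)
    [set v | dotv v v = 1] _ compact_unit_sphere.
- by have [k _ uk] := normalize u u0; exists (k *: u).
- exact/continuous_subspaceT/quadratic_form_continuous.
rewrite inE /= => v1 vmax; set m := dotv (v *m A) v.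
have qle w : dotv (w *m A) w <= m * dotv w w.
  have [->|w0] := eqVneq w 0; first by rewrite mul0mx /dotv mul0mx mxE mulr0.
  have [k k0 wk] := normalize w w0.
  have := vmax (k *: w); rewrite inE /= => /(_ wk).
  rewrite -/m -[leRHS]mulr1 -wk -scalemxAl !dotv_lin => kw.
  by rewrite -(ler_pM2l k0) -(ler_pM2l k0); lra.
have vA : v *m A = m *: v.
  apply/eqP; rewrite eq_sym -subr_eq0 -mul_mx_scalar -mulmxBr; apply/eqP.
  apply: psd_form_kernel => [|].
    split=> [|w]; first by rewrite linearB/= tr_scalar_mx AT.
    rewrite -/(dotv _ _) mulmxBr mul_mx_scalar !dotv_lin subr_ge0.
    exact: qle.
  by rewrite mulmxBr mul_mx_scalar !dotv_lin v1 mulr1 subrr.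
have : eigenvalue A m.
  apply/eigenvalueP; exists v => //; rewrite -dotvv_eq0 v1; exact: oner_neq0.
move=> /Al ml; apply: le_trans (qle u) _.
by rewrite ler_wpM2r// dotvv_ge0.
Qed.

End Rayleigh.

(* The stepsize range is (0, 1.75 / Leff] with Leff = kappa * LA, read as
   (0, +oo) in the degenerate case Leff = 0 (i.e. A = 0). *)
Theorem theorem3p1 (R : realType) (d : nat) (f : 'rV[R]_d -> R)
    (x0 : 'rV[R]_d) (kappa : R) (A : 'M[R]_d) (LA : R) (eta : R)
    (f_diff : forall x, differentiable f x)
    (f_convex : convex_function setT f)
    (f_C2 : C2_on (sublevel f (f x0)) f)
    (kappa_gt0 : 0 < kappa)
    (A_psd : psd A)
    (LA_max : largest_eigenvalue A LA)
    (hess_le : forall x, sublevel f (f x0) x ->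
       loewner_le (hessian f x) (kappa *: A))
    (eta_gt0 : 0 < eta)
    (eta_le : 0 < kappa * LA -> eta <= (7 / 4) / (kappa * LA)) :
  convex_seq (fun n => f (gd f eta x0 n)).
Proof.
(* The smoothness constant is enlarged so that the step is exactly [7/4 / L]. *)
pose L := 7 / 4 / eta.
have L_gt0 : 0 < L by rewrite divr_gt0.
have etaE : eta = 7 / 4 / L by rewrite /L invf_div mulrCA divff ?mulr1.
have Leff_le : kappa * LA <= L.
  have [kLA|kLA] := ltP 0 (kappa * LA); last exact: le_trans kLA (ltW L_gt0).
  by rewrite ler_pdivlMr// mulrC -ler_pdivlMr// eta_le.
(* Symmetry of the Hessian is read off from the Loewner bound: [kappa *: A - hessian f x] and [A]
   are both symmetric. *)
have hess_sym x : f x <= f x0 -> (hessian f x)^T = hessian f x.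
  move=> /hess_le[+ _]; rewrite linearB/= linearZ/= (proj1 A_psd).
  by move/addrI/oppr_inj.
have hess_leL x u : f x <= f x0 -> dotv (u *m hessian f x) u <= L * dotv u u.
  move=> /hess_le[_ /(_ u)]; rewrite -/(dotv _ _) mulmxBr -scalemxAr !dotv_lin.
  rewrite subr_ge0 => /le_trans; apply.
  apply: (@le_trans _ _ (kappa * (LA * dotv u u))).
    rewrite ler_pM2l//.
    exact: (rayleigh_le A LA (proj1 A_psd) (proj2 LA_max)).
  by rewrite mulrA ler_wpM2r// dotvv_ge0.
have gdS n : gd f eta x0 n.+1 =
    gd f eta x0 n - (7 / 4 / L) *: grad f (gd f eta x0 n) by rewrite -etaE.
clearbody L; move=> n.
apply: (gd_step_convex f (f x0) L f_diff f_convex L_gt0 (proj1 f_C2)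
  hess_sym hess_leL _ _ _ (gdS n) (gdS n.+1)).
(* By induction every iterate stays in the initial sublevel set. *)
elim: n => [|n IHn]; first exact: lexx.
rewrite gdS.
exact: (sublevel_gd_step f (f x0) L f_diff f_convex L_gt0 (proj1 f_C2)).
Qed.
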